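(* Let $H\in M_N(\mathbb C)$ be a complex Hadamard matrix, and let $G_H,G_{H^t}\subset S_N^+$ be the quantum groups associated to $H$ and to its transpose $H^t$. Then for all integers $p,r\geq1$ we have $$\int_{G_H}^r\left(\frac{\chi}{N}\right)^p=\int_{G_{H^t}}^p\left(\frac{\chi}{N}\right)^r,$$ where on each side $\chi=\sum_iu_{ii}$ is the main character of the corresponding quantum group.
   Context: A complex Hadamard matrix is a matrix $H\in M_N(\mathbb C)$ with entries on the unit circle $\mathbb T$ and pairwise orthogonal rows; then $H^t$ is Hadamard too. A magic matrix is a square matrix over a $C^*$-algebra whose entries are projections ($p=p^2=p^*$) summing up to $1$ on each row and column. $C(S_N^+)$ is the universal $C^*$-algebra generated by the entries of an $N\times N$ magic matrix $u=(u_{ij})$, with $\Delta(u_{ij})=\sum_ku_{ik}\otimes u_{kj}$, $\varepsilon(u_{ij})=\delta_{ij}$, $S(u_{ij})=u_{ji}$. Let $H_1,\ldots,H_N\in\mathbb T^N$ be the rows of $H$, and let $P_{ij}=Proj(H_i/H_j)\in M_N(\mathbb C)$ be the rank one orthogonal projection onto the line spanned by the entrywise quotient $H_i/H_j$, that is, $(P_{ij})_{kl}=\frac1N\cdot\frac{H_{ik}H_{jl}}{H_{il}H_{jk}}$. Then $(P_{ij})$ is magic, so $\pi:u_{ij}\mapsto P_{ij}$ defines a $*$-homomorphism $C(S_N^+)\to M_N(\mathbb C)$. The quantum group $G=G_H\subset S_N^+$ is the minimal one for which $\pi$ factors as $C(S_N^+)\to C(G)\xrightarrow{\rho}M_N(\mathbb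 C)$, the first map being the quotient map of Hopf algebras corresponding to $G\subset S_N^+$ (at the level of the $*$-algebras generated by the $u_{ij}$: divide by the largest Hopf $*$-ideal contained in $\ker\pi$; $C(G)$ is the enveloping $C^*$-algebra of the quotient). The images of $u_{ij}$ in $C(G)$ are still denoted $u_{ij}$. $tr$ is the normalized trace on $M_N(\mathbb C)$; convolution of functionals on $C(G)$ is $\psi*\phi=(\psi\otimes\phi)\Delta$, and $\int_G^r=(tr\circ\rho)^{*r}$. *)

(* Defs.v *)
From HB Require Import structures.
From mathcomp Require Import all_boot all_order all_algebra.
From mathcomp Require Import finmap complex.
From mathcomp Require Import boolp classical_sets reals monalg.

Set Implicit Arguments.
Unset Strict Implicit.
Unset Printing Implicit Defensive.

Import Order.TTheory GRing.Theory Num.Theory.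

Local Open Scope classical_set_scope.
Local Open Scope ring_scope.

Local Notation "x %:C" := (x%:C)%C : ring_scope.

HB.mixin Record isCstarAlgebra (R : realType) A of GRing.Algebra R[i] A := {
  star : A -> A;
  starK : involutive star;
  starD : {morph star : a b / a + b};
  starZ : forall (c : R[i]) (a : A), star (c *: a) = c^* *: star a;
  starM : forall a b : A, star (a * b) = star b * star a;
  cnorm : A -> R;
  cnorm_ge0 : forall a, 0 <= cnorm a;
  cnorm_eq0 : forall a, cnorm a = 0 -> a = 0;
  cnormD : forall a b, cnorm (a + b) <= cnorm a + cnorm b;
  cnormZ : forall (c : R[i]) (a : A), (cnorm (c *: a))%:C = `|c| * (cnorm a)%:C;
  cnormM : forall a b : A, cnorm (a * b) <= cnorm a * cnorm b;
  cnorm_star_mul : forall a : A, cnorm (star a * a) = cnorm a ^+ 2;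
  cnorm_complete : forall x : nat -> A,
    (forall e : R, 0 < e -> exists K : nat, forall p q : nat,
       (K <= p)%N -> (K <= q)%N -> cnorm (x p - x q) < e) ->
    exists l : A, forall e : R, 0 < e -> exists K : nat, forall p : nat,
       (K <= p)%N -> cnorm (x p - l) < e
}.

#[short(type="cstarType")]
HB.structure Definition CstarAlgebra (R : realType) :=
  {A of GRing.Algebra R[i] A & isCstarAlgebra R A}.

(* Every unital *-homomorphism of C*-algebras is contractive; this is part of
   the definition only for convenience. *)
Definition star_hom (R : realType) (A B : cstarType R)
    (f : {lrmorphism A -> B}) : Prop :=
  (forall a, f (star a) = star (f a)) /\ (forall a, cnorm (f a) <= cnorm a).

Definition functional (R : realType) (A : cstarType R) (f : A -> R[i]) : Prop :=
  scalar f /\ exists M : R, forall a, `|f a| <= (M * cnorm a)%:C.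

Definition lin_indep (K : fieldType) (V : lmodType K) (m : nat)
    (b : 'I_m -> V) : Prop :=
  forall c : 'I_m -> K, \sum_k c k *: b k = 0 -> forall k, c k = 0.

(* A C*-tensor product of A and B: a completion of the algebraic tensor product
   for some C*-norm (minimal, maximal or intermediate). The axiom tens_inj says
   that the algebraic tensor product embeds. The product f (x) g of functionals
   is uniquely determined by tensfP; it exists for every C*-norm, because it
   exists for the spatial one, which is the smallest. *)
Record cstar_tensor (R : realType) (A B : cstarType R) := CstarTensor {
  tensor_alg :> cstarType R;
  tens : A -> B -> tensor_alg;
  tensDl : forall a a' b, tens (a + a') b = tens a b + tens a' b;
  tensDr : forall a b b', tens a (b + b') = tens a b + tens a b';
  tensZl : forall (c : R[i]) a b, tens (c *: a) b = c *: tens a b;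
  tensZr : forall (c : R[i]) a b, tens a (c *: b) = c *: tens a b;
  tens11 : tens 1 1 = 1;
  tensM : forall a a' b b', tens a b * tens a' b' = tens (a * a') (b * b');
  tens_star : forall a b, star (tens a b) = tens (star a) (star b);
  tens_inj : forall (m : nat) (a : 'I_m -> A) (b : 'I_m -> B),
    lin_indep b -> \sum_k tens (a k) (b k) = 0 -> forall k, a k = 0;
  tens_dense : forall (t : tensor_alg) (e : R), 0 < e ->
    exists (m : nat) (a : 'I_m -> A) (b : 'I_m -> B),
      cnorm (t - \sum_k tens (a k) (b k)) < e;
  tensf : (A -> R[i]) -> (B -> R[i]) -> tensor_alg -> R[i];
  tensfP : forall f g, functional f -> functional g ->
    functional (tensf f g) /\ forall a b, tensf f g (tens a b) = f a * g b
}.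

Arguments tensf {R A B}.

Definition magic (R : realType) (A : cstarType R) (N : nat)
    (v : 'I_N -> 'I_N -> A) : Prop :=
  [/\ forall i j, v i j * v i j = v i j /\ star (v i j) = v i j,
      forall i, \sum_j v i j = 1
    & forall j, \sum_i v i j = 1].

(* The free *-algebra on N^2 self-adjoint generators u_ij: the monoid algebra of
   the words in the letters (i, j). *)
Definition word (N : nat) := fmonom ('I_N * 'I_N)%type.
Definition freeA (R : realType) (N : nat) := malg (word N) R[i].

Section WordPair.
Variable N : nat.
Local Notation W2 := (word N * word N)%type.

Definition wpair1 : W2 := (one, one).
Definition wpairM (x y : W2) : W2 := (mul x.1 y.1, mul x.2 y.2).

Fact wpairMA : associative wpairM.
Proof. by move=> x y z; rewrite /wpairM /= !mulmA. Qed.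
Fact wpair1M : left_id wpair1 wpairM.
Proof. by case=> x y; rewrite /wpairM /= !mul1m. Qed.
Fact wpairM1 : right_id wpair1 wpairM.
Proof. by case=> x y; rewrite /wpairM /= !mulm1. Qed.
Fact wpair_unit x y : wpairM x y = wpair1 -> x = wpair1 /\ y = wpair1.
Proof.
case: x y => [x1 x2] [y1 y2] []; rewrite /wpair1.
by move=> /unitm[-> ->] /unitm[-> ->].
Qed.

HB.instance Definition _ := Choice_isMonomialDef.Build W2
  wpairMA wpair1M wpairM1 wpair_unit.
End WordPair.

(* The algebraic tensor square of the free algebra, as the monoid algebra of the
   pairs of words. *)
Definition freeA2 (R : realType) (N : nat) := malg (word N * word N)%type R[i].

Section FreeAlgebra.
Variables (R : realType) (N : nat).
Local Notation F := (freeA R N).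
Local Notation F2 := (freeA2 R N).

(* The unital algebra homomorphism from the free algebra sending u_ij to v_ij;
   it is a *-homomorphism as soon as all the v_ij are self-adjoint. *)
Definition ev (S : lalgType R[i]) (v : 'I_N -> 'I_N -> S) : F -> S :=
  mmap (fun c : R[i] => c%:A) (fun w : word N => \prod_(ij <- w) v ij.1 ij.2).

Definition letter (i j : 'I_N) : word N := fmu (i, j).

Definition ftens (a b : F) : F2 :=
  \sum_(w <- msupp a) \sum_(w' <- msupp b)
    mkmalgU (w, w') (mcoeff w a * mcoeff w' b).

(* u_ij^* = u_ij, extended antilinearly and antimultiplicatively *)
Definition fstar (x : F) : F :=
  \sum_(w <- msupp x) mkmalgU (FMonom (rev w)) (mcoeff w x)^*.

Definition comul : F -> F2 :=
  ev (fun i j => \sum_(k < N) mkmalgU (letter i k, letter k j) 1 : F2).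

Definition counit : F -> R[i]^o := ev (fun i j => (i == j)%:R : R[i]^o).

(* S(u_ij) = u_ji, extended linearly and antimultiplicatively *)
Definition antipode (x : F) : F :=
  \sum_(w <- msupp x)
    mkmalgU (FMonom (rev [seq (ij.2, ij.1) | ij <- w])) (mcoeff w x).

(* The kernel of the map from the free *-algebra to C(S_N^+), so that the
   *-algebra Pol(S_N^+) generated by the u_ij inside C(S_N^+) is the quotient by
   it: by universality of C(S_N^+), x vanishes there iff it is killed by all
   magic matrices over C*-algebras. *)
Definition magic_ker : set F := [set x |
  forall (A : cstarType R) (v : 'I_N -> 'I_N -> A), magic v -> ev v x = 0].

Definition tensor_ideal (I : set F) : set F2 := [set z |
  exists s : seq (F * F),
    (forall ab, ab \in s -> I ab.1 \/ I ab.2) /\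
    z = \sum_(ab <- s) ftens ab.1 ab.2].

(* Subspaces of Pol(S_N^+) are represented by their preimages in the free
   algebra, which are the subspaces containing magic_ker. *)
Definition hopf_star_ideal (I : set F) : Prop :=
  [/\ magic_ker `<=` I,
      forall (c : R[i]) x y, I x -> I y -> I (c *: x + y),
      forall x y z, I y -> I (x * y * z)
    & forall x, I x ->
        [/\ I (fstar x), tensor_ideal I (comul x), counit x = 0
          & I (antipode x)]].

End FreeAlgebra.

(* The pair (A, u) is the enveloping C*-algebra of the quotient of the free
   *-algebra by J. A *-homomorphism from that quotient to a C*-algebra B is a
   self-adjoint family w in B such that ev w kills J. *)
Definition enveloping (R : realType) (N : nat) (J : set (freeA R N))
    (A : cstarType R) (u : 'I_N -> 'I_N -> A) : Prop :=
  [/\ forall i j, star (u i j) = u i j,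
      forall x, J x -> ev u x = 0
    & forall (B : cstarType R) (w : 'I_N -> 'I_N -> B),
        (forall i j, star (w i j) = w i j) ->
        (forall x, J x -> ev w x = 0) ->
        exists f : {lrmorphism A -> B},
          (star_hom f /\ forall i j, f (u i j) = w i j) /\
          forall g : {lrmorphism A -> B},
            star_hom g /\ (forall i j, g (u i j) = w i j) -> g =1 f].

Section Hadamard.
Variables (R : realType) (n : nat).
Local Notation C := R[i].
Local Notation N := n.+1.

Definition hadamard (H : 'M[C]_N) : Prop :=
  (forall i j, `|H i j| = 1) /\
  (forall i j, i != j -> \sum_k H i k * (H j k)^* = 0).

Definition adjmx (p q : nat) (A : 'M[C]_(p, q)) : 'M[C]_(q, p) :=
  map_mx Num.conj A^T.

Definition proj_line (v : 'cV[C]_N) : 'M[C]_N :=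
  ((adjmx v *m v) 0 0)^-1 *: (v *m adjmx v).

Definition hadamard_proj (H : 'M[C]_N) (i j : 'I_N) : 'M[C]_N :=
  proj_line (\col_k (H i k / H j k)).

Lemma hadamard_projE (H : 'M[C]_N) (i j k l : 'I_N) : hadamard H ->
  hadamard_proj H i j k l =
  N%:R^-1 * ((H i k * H j l) / (H i l * H j k)).
Proof.
move=> [H1 _].
have conjV a b : (H a b)^* = (H a b)^-1.
  by rewrite invC_norm H1 expr1n invr1 mul1r.
have Hn0 a b : H a b != 0 by rewrite -normr_eq0 H1 oner_eq0.
rewrite /hadamard_proj /proj_line !mxE big_ord1 !mxE.
under eq_bigr => m _.
  rewrite !mxE -normCKC normf_div !H1 divr1 expr1n; over.
rewrite sumr_const card_ord; congr (_ * _).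
rewrite rmorphM fmorphV /= !conjV invrK invfM.
by rewrite -!mulrA; congr (_ * _); rewrite mulrC -mulrA [X in _ = X]mulrCA.
Qed.

(* A sum of Hopf *-ideals contained in the kernel of pi = ev (hadamard_proj H)
   is again one, so this union is the largest of them. *)
Definition hopf_image_ker (H : 'M[C]_N) : set (freeA R N) := [set x |
  exists I : set (freeA R N),
    [/\ hopf_star_ideal I, forall y, I y -> ev (hadamard_proj H) y = 0 & I x]].

(* The quantum group G of a Hadamard matrix: the enveloping C*-algebra C(G) with
   its generators u_ij, the C*-algebra C(G) (x) C(G) with the comultiplication,
   and the factorization rho of pi. *)
Record hadamard_qgroup (H : 'M[C]_N) := HadamardQGroup {
  CG : cstarType R;
  gen : 'I_N -> 'I_N -> CG;
  CG_enveloping : enveloping (hopf_image_ker H) gen;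
  CGG : cstar_tensor CG CG;
  Delta : {lrmorphism CG -> CGG};
  Delta_star_hom : star_hom Delta;
  Delta_gen : forall i j, Delta (gen i j) = \sum_k tens CGG (gen i k) (gen k j);
  rho : {lrmorphism CG -> 'M[C]_N};
  rho_star : forall a, rho (star a) = adjmx (rho a);
  (* automatic, as for star_hom *)
  rho_bounded : exists M : R, forall a k l,
    `|rho a k l| <= (M * cnorm a)%:C;
  rho_gen : forall i j, rho (gen i j) = hadamard_proj H i j
}.

Section QGroup.
Variables (H : 'M[C]_N) (G : hadamard_qgroup H).

Definition convolution (psi phi : CG G -> C) : CG G -> C :=
  fun a => tensf (CGG G) psi phi (Delta G a).

Definition tr_rho (a : CG G) : C := N%:R^-1 * \tr (rho G a).

(* The convolution power (tr o rho)^{*r}; only r >= 1 is meaningful. *)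
Definition trunc_int (r : nat) : CG G -> C :=
  iter r.-1 (fun psi => convolution psi tr_rho) tr_rho.

Definition main_char : CG G := \sum_i gen G i i.

End QGroup.
End Hadamard.

Arguments convolution {R n H} G psi phi a.
Arguments tr_rho {R n H} G a.
Arguments trunc_int {R n H} G r a.
Arguments main_char {R n H} G.

(* Main.v *)
(* On the words u_(i_1 j_1) ... u_(i_p j_p), convolution of functionals is the
   product of matrices indexed by p-tuples. Both tr and the integral of chi^p are
   thus traces of matrix products, i.e. sums over cyclic sequences, so that the
   left-hand side is N^(-p-r) times a sum over two arrays x, y of size r x p, with
   both directions cyclic, of
     prod_(t,s) (P_(x(t,s) x(t+1,s)))_(y(t,s) y(t,s+1)).
   Since (P_ij)_kl = H_ik H_jl / (N H_il H_jk) is invariant under exchanging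
   (i, j) with (k, l) and H with H^t, transposing the arrays and exchanging x
   with y gives the right-hand side. *)
Require Import Defs.
From HB Require Import structures.
From mathcomp Require Import all_boot all_order all_algebra.
From mathcomp Require Import complex reals.

Set Implicit Arguments.
Unset Strict Implicit.
Unset Printing Implicit Defensive.

Import Order.TTheory GRing.Theory Num.Theory.
Local Open Scope ring_scope.

Section CyclicSums.
Variables (K : comPzRingType) (I : finType).

Lemma sum_ffun_recr r (Q : {ffun 'I_r.+1 -> I} -> K) :
  \sum_a Q a =
  \sum_k \sum_(a : {ffun 'I_r -> I})
    Q [ffun s => if unlift ord_max s is Some s' then a s' else k].
Proof.
rewrite pair_big /=.
rewrite (reindex (fun ka : I * {ffun 'I_r -> I} =>
  [ffun s => if unlift ord_max s is Some s' then ka.2 s' else ka.1])) //=.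
exists (fun b => (b ord_max, [ffun s => b (lift ord_max s)])).
  case=> k a _ /=; rewrite ffunE unlift_none; congr pair.
  by apply/ffunP => s; rewrite !ffunE liftK.
move=> b _ /=; apply/ffunP => s; rewrite ffunE.
by case: unliftP => [s'|] ->; rewrite ?ffunE.
Qed.

(** [F r] stands for the product of the matrices [A 0], ..., [A r], whose entries are sums over
    paths. It is given by a recurrence so that it can also be instantiated with functionals
    evaluated on words. The endpoint [j] stays outside the path [a], ready to be identified with the
    starting point. *)
Lemma sum_paths (A F : nat -> I -> I -> K) :
    (forall i j, F 0%N i j = A 0%N i j) ->
    (forall r i j, F r.+1 i j = \sum_k F r i k * A r.+1 k j) ->
  forall r i j, F r i j =
    \sum_(a : {ffun 'I_r.+1 -> I} | a ord0 == i)
      (\prod_(s < r) A s (a (widen_ord (leqnSn r) s)) (a (lift ord0 s)))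
      * A r (a ord_max) j.
Proof.
move=> F0 FS; elim=> [|r IH] i j.
  rewrite F0 (big_pred1 [ffun=> i]) ?big_ord0 ?mul1r ?ffunE // => a.
  apply/eqP/eqP => [<-|->]; last by rewrite ffunE.
  by apply/ffunP => s; rewrite ffunE ord1.
rewrite FS [RHS]big_mkcond sum_ffun_recr; apply: eq_bigr => k _.
rewrite IH mulr_suml [LHS]big_mkcond; apply: eq_bigr => a _.
(* The summation index [k] of the last product becomes the last vertex of the extended path [b]. *)
set b := [ffun s => _].
have bw s : b (widen_ord (leqnSn r.+1) s) = a s.
  rewrite ffunE; have -> : widen_ord (leqnSn r.+1) s = lift ord_max s.
    by apply: val_inj; rewrite [RHS]lift_max.
  by rewrite liftK.
have bmax : b ord_max = k by rewrite ffunE unlift_none.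
have -> : b ord0 = a ord0 by rewrite -(bw ord0); congr (b _); apply: val_inj.
case: eqP => // _; rewrite big_ord_recr /= !bw bmax.
have -> : lift ord0 (@ord_max r) = ord_max by apply: val_inj.
rewrite bmax; congr (_ * _ * _); apply: eq_bigr => s _.
rewrite bw -(bw (lift ord0 s)); congr (A _ (a _) (b _)); exact: val_inj.
Qed.

(** On the diagonal the last edge returns to the start; it is the factor at [ord_max], where [ordS]
    wraps around. *)
Lemma sum_closed_paths (A F : nat -> I -> I -> K) :
    (forall i j, F 0%N i j = A 0%N i j) ->
    (forall r i j, F r.+1 i j = \sum_k F r i k * A r.+1 k j) ->
  forall r, \sum_i F r i i =
    \sum_(a : {ffun 'I_r.+1 -> I}) \prod_(s < r.+1) A s (a s) (a (ordS s)).
Proof.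
move=> F0 FS r.
under eq_bigr do rewrite (sum_paths F0 FS).
rewrite [RHS](partition_big (fun a : {ffun 'I_r.+1 -> I} => a ord0) xpredT) //=.
apply: eq_bigr => i _; apply: eq_bigr => a /eqP a0.
rewrite big_ord_recr /=; congr (_ * A _ _ _).
  apply: eq_bigr => s _; congr (A _ _ (a _)).
  by apply: val_inj; rewrite /= modn_small // ltnS.
by rewrite -a0; congr (a _); apply: val_inj; rewrite /= modnn.
Qed.

End CyclicSums.

Lemma mxtrace_prod (K : comNzRingType) n p (B : 'I_p.+1 -> 'M[K]_n.+1) :
  \tr (\prod_s B s) =
  \sum_(a : {ffun 'I_p.+1 -> 'I_n.+1}) \prod_s B s (a s) (a (ordS s)).
Proof.
(* [inord] extends the family to all naturals; only the indices up to [p] enter. *)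
pose A s i j := B (inord s) i j.
pose F r i j := (\prod_(s < r.+1) B (inord s)) i j.
have F0 i j : F 0%N i j = A 0%N i j by rewrite /F big_ord1.
have FS r i j : F r.+1 i j = \sum_k F r i k * A r.+1 k j.
  by rewrite /F big_ord_recr /= mxE.
have -> : \prod_s B s = \prod_(s < p.+1) B (inord s).
  by apply: eq_bigr => s _; rewrite inord_val.
rewrite -[LHS]/(\sum_i F p i i) (sum_closed_paths F0 FS).
by apply: eq_bigr => a _; apply: eq_bigr => s _; rewrite /A inord_val.
Qed.

Section Functional.
Variables (R : realType) (A : cstarType R) (f : A -> R[i]).
Hypothesis ff : functional f.

Lemma functional0 : f 0 = 0.
Proof.
by apply: (addrI (f 0)); rewrite addr0 -{1}[f 0]mul1r -ff.1 scaler0 addr0.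
Qed.

Lemma functionalZ c a : f (c *: a) = c * f a.
Proof. by rewrite -[c *: a]addr0 ff.1 functional0 addr0. Qed.

Lemma functional_sum (I : finType) (F : I -> A) :
  f (\sum_i F i) = \sum_i f (F i).
Proof.
apply: (big_morph f); last exact: functional0.
by move=> a b; rewrite -{1}[a]scale1r ff.1 mul1r.
Qed.

End Functional.

Lemma tens_prod (R : realType) (A B : cstarType R) (T : cstar_tensor A B) p
    (a : 'I_p -> A) (b : 'I_p -> B) :
  \prod_s tens T (a s) (b s) = tens T (\prod_s a s) (\prod_s b s).
Proof.
elim: p a b => [|p IH] a b; first by rewrite !big_ord0 tens11.
by rewrite !big_ord_recl IH tensM.
Qed.

(* Row orthogonality says that H^* / N is a right inverse of H; being also a left
   inverse, it gives column orthogonality. *)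
Lemma hadamard_tr (R : realType) n (H : 'M[R[i]]_n.+1) :
  hadamard H -> hadamard H^T.
Proof.
move=> [H1 H0]; split=> [i j|i j ij]; first by rewrite mxE.
have N0 : n.+1%:R != 0 :> R[i] by rewrite pnatr_eq0.
have HH : H *m (n.+1%:R^-1 *: adjmx H) = 1%:M.
  rewrite -scalemxAr; apply/matrixP => a b; rewrite !mxE.
  under eq_bigr do rewrite !mxE.
  have [<-|ab] := eqVneq; last by rewrite H0 // mulr0.
  under eq_bigr do rewrite -normCK H1 expr1n.
  by rewrite sumr_const card_ord mulVf.
have /matrixP/(_ j i) := mulmx1C HH.
rewrite -scalemxAl !mxE eq_sym (negbTE ij) => /eqP.
rewrite mulf_eq0 invr_eq0 (negbTE N0) /= => /eqP adjHH; rewrite -[RHS]adjHH.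
by apply: eq_bigr => k _; rewrite !mxE mulrC.
Qed.

Section QGroup.
Variables (R : realType) (n : nat) (H : 'M[R[i]]_n.+1) (G : hadamard_qgroup H).

Lemma tr_rho_functional : functional (tr_rho G).
Proof.
split=> [c a b|].
  by rewrite /tr_rho linearP mxtraceD mxtraceZ mulrDr mulrCA.
have [M rhoM] := rho_bounded G; exists M => a.
rewrite /tr_rho normrM normfV normr_nat ler_pdivrMl ?ltr0n //.
apply: le_trans (ler_norm_sum _ _ _) _.
apply: le_trans (ler_sum _ (fun i _ => rhoM a i i)) _.
by rewrite sumr_const card_ord mulr_natl.
Qed.

Lemma convolution_functional psi phi :
  functional psi -> functional phi -> functional (convolution G psi phi).
Proof.
move=> fpsi fphi; have [[tlin [M tM]] _] := tensfP (CGG G) fpsi fphi.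
split=> [c a b|]; first by rewrite /convolution linearP tlin.
(* The sign of [M] is unknown, and contractivity of [Delta] can only be multiplied by a nonnegative
   constant. *)
exists `|M| => a; apply: le_trans (tM _) _.
rewrite lecR; apply: le_trans (ler_wpM2r (cnorm_ge0 _) (ler_norm M)) _.
by apply: ler_wpM2l => //; apply: (Delta_star_hom G).2.
Qed.

(** Boundedness is carried along because [tensfP] describes the product of functionals only for
    bounded ones. *)
Lemma trunc_int_functional r : functional (trunc_int G r).
Proof.
rewrite /trunc_int; elim: r.-1 => [|m IH] /=; first exact: tr_rho_functional.
exact: convolution_functional IH tr_rho_functional.
Qed.

Definition gen_word p (i j : {ffun 'I_p -> 'I_n.+1}) : CG G :=
  \prod_s gen G (i s) (j s).

(** Words of length [p] are the coefficients of the [p]-th tensor power of the fundamental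
    corepresentation, so convolving functionals multiplies their matrices of values on words. *)
Lemma Delta_gen_word p (i j : {ffun 'I_p -> 'I_n.+1}) :
  Delta G (gen_word i j) =
  \sum_k tens (CGG G) (gen_word i k) (gen_word k j).
Proof.
rewrite rmorph_prod (eq_bigr _ (fun s _ => Delta_gen G (i s) (j s))).
rewrite bigA_distr_bigA /=; apply: eq_bigr => k _; exact: tens_prod.
Qed.

Lemma tr_rho_gen_word p (i j : {ffun 'I_p.+1 -> 'I_n.+1}) :
  tr_rho G (gen_word i j) =
  n.+1%:R^-1 * \sum_(a : {ffun 'I_p.+1 -> 'I_n.+1})
    \prod_s hadamard_proj H (i s) (j s) (a s) (a (ordS s)).
Proof.
rewrite /tr_rho rmorph_prod (eq_bigr _ (fun s _ => rho_gen G (i s) (j s))).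
by rewrite mxtrace_prod.
Qed.

Lemma main_charX p : main_char G ^+ p = \sum_i gen_word (p := p) i i.
Proof.
rewrite -[p in LHS]card_ord -prodr_const bigA_distr_bigA /=.
by apply: eq_bigr.
Qed.

Lemma trunc_int_main_char p r :
  trunc_int G r.+1 ((n.+1%:R^-1 *: main_char G) ^+ p.+1) =
  n.+1%:R^-1 ^+ p.+1 * n.+1%:R^-1 ^+ r.+1 *
  \sum_(x : {ffun 'I_r.+1 -> {ffun 'I_p.+1 -> 'I_n.+1}})
  \sum_(y : {ffun 'I_r.+1 -> {ffun 'I_p.+1 -> 'I_n.+1}})
    \prod_t \prod_s hadamard_proj H (x t s) (x (ordS t) s)
                                    (y t s) (y t (ordS s)).
Proof.
rewrite exprZn (functionalZ (trunc_int_functional _)) main_charX.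
rewrite (functional_sum (trunc_int_functional _)) -mulrA; congr (_ * _).
(* Each convolution multiplies by the same matrix, so [A] ignores its first argument. The shift
   [m.+1] in [F] makes the powers start at [tr_rho] itself. *)
pose A (_ : nat) i j := tr_rho G (gen_word (p := p.+1) i j).
pose F m i j := trunc_int G m.+1 (gen_word (p := p.+1) i j).
have F0 i j : F 0%N i j = A 0%N i j by [].
have FS m i j : F m.+1 i j = \sum_k F m i k * A m.+1 k j.
  have [tf tE] :=
    tensfP (CGG G) (trunc_int_functional m.+1) tr_rho_functional.
  rewrite /F -[trunc_int G m.+2]/(convolution G (trunc_int G m.+1) (tr_rho G)).
  by rewrite /convolution Delta_gen_word (functional_sum tf); apply: eq_bigr.
(* The closed path of tuples is [x]. Each of its [r.+1] edges is a normalized trace, giving one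
   factor [n.+1%:R^-1] and one row of [y]. *)
rewrite (sum_closed_paths F0 FS) mulr_sumr; apply: eq_bigr => x _.
rewrite /A; under eq_bigr do rewrite tr_rho_gen_word.
by rewrite big_split /= prodr_const card_ord bigA_distr_bigA.
Qed.

End QGroup.

Lemma reindex_ffun_tr (K : nmodType) (I J T : finType)
    (Q : {ffun I -> {ffun J -> T}} -> K) :
  \sum_x Q x =
  \sum_(x : {ffun J -> {ffun I -> T}}) Q [ffun i => [ffun j => x j i]].
Proof.
apply: reindex; exists (fun x : {ffun I -> {ffun J -> T}} => [ffun j => [ffun i => x i j]]);
  by move=> x _; apply/ffunP => i; apply/ffunP => j; rewrite !ffunE.
Qed.

Theorem theoremB (R : realType) (n : nat) (H : 'M[R[i]]_n.+1)
  (hH : hadamard H)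
  (G : hadamard_qgroup H) (Gt : hadamard_qgroup H^T)
  (p r : nat) (hp : (1 <= p)%N) (hr : (1 <= r)%N) :
  trunc_int G r ((n.+1%:R^-1 *: main_char G) ^+ p)
  = trunc_int Gt p ((n.+1%:R^-1 *: main_char Gt) ^+ r).
Proof.
case: p r hp hr => [//|p] [//|r] _ _.
rewrite !trunc_int_main_char; congr (_ * _); first exact: mulrC.
(* The transpose of the left-hand [y] is matched with the outer array on the right, that of [x] with
   the inner one. *)
rewrite exchange_big reindex_ffun_tr; apply: eq_bigr => y _ /=.
rewrite reindex_ffun_tr; apply: eq_bigr => x _.
rewrite exchange_big; apply: eq_bigr => s _; apply: eq_bigr => t _.
rewrite !hadamard_projE //; last exact: hadamard_tr.
(* The numerators agree, and the denominators differ only in the order of their two factors. *)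
by rewrite !ffunE !mxE; congr (_ * (_ / _)); rewrite mulrC.
Qed.
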